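(* Let $x\in\mathcal V$ have the coefficient tensor $\mathbf X\in\mathbb R^{d_1\times d_2\times\dots\times d_N}$, i.e. $x=\operatorname{vec}(\mathbf X)^{\mathsf T}\,[\Psi_N\otimes\dotsm\otimes\Psi_2\otimes\Psi_1]$. Let $i\in\{1,\dots,N\}$ and $\hat d_i\le d_i$, and let $V_{i,\hat d_i}\in\mathbb R^{d_i\times\hat d_i}$ be the matrix of the $\hat d_i$ leading left singular vectors of $$\mathbf L_{\mathcal V_i}^{\mathsf T}\,(\Pi^{i-1}\mathbf X)^{(1)}\,\bigl[\mathbf L_{\mathcal V_{i-1}}\otimes\dotsm\otimes\mathbf L_{\mathcal V_1}\otimes\mathbf L_{\mathcal V_N}\otimes\dotsm\otimes\mathbf L_{\mathcal V_{i+1}}\bigr].$$ Define $$\hat\Psi_i=\begin{bmatrix}\hat\psi_i^1\\ \vdots\\ \hat\psi_i^{\hat d_i}\end{bmatrix}:=V_{i,\hat d_i}^{\mathsf T}\,\mathbf L_{\mathcal V_i}^{-1}\,\Psi_i,\qquad \hat{\mathcal V}_i:=\operatorname{span}\{\hat\psi_i^1,\dots,\hat\psi_i^{\hat d_i}\}\subset\mathcal V_i.$$ Then $\hat{\mathcal V}_i$ optimally approximates $\mathcal V_i$ in the sense that $x$ is best approximated in $$\mathcal V_1\cdot\mathcal V_2\dotsm\mathcal V_{i-1}\cdot\hat{\mathcal V}_i\cdot\mathcal V_{i+1}\dotsm\mathcal V_N$$ in the $\mathcal V$-norm over all subspaces of $\mathcal V_i$ of dimension $\hat d_i$; that is, for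 every subspace $\mathcal W\subset\mathcal V_i$ with $\dim\mathcal W=\hat d_i$, $$\min_{z\in\mathcal V_1\dotsm\mathcal V_{i-1}\cdot\hat{\mathcal V}_i\cdot\mathcal V_{i+1}\dotsm\mathcal V_N}\|x-z\|_{\mathcal V}\ \le\ \min_{z\in\mathcal V_1\dotsm\mathcal V_{i-1}\cdot\mathcal W\cdot\mathcal V_{i+1}\dotsm\mathcal V_N}\|x-z\|_{\mathcal V}.$$
   Context: Spaces. For $i=1,\dots,N$, $\mathcal V_i=\operatorname{span}\{\psi_i^1,\dots,\psi_i^{d_i}\}$ is a $d_i$-dimensional Hilbert space of real-valued square integrable functions with respect to a measure denoted $\mathrm d_i$ (the measure associated with $\mathcal V_i$), so $\psi_i^1,\dots,\psi_i^{d_i}$ is a basis of $\mathcal V_i$ and $(u,v)_{\mathcal V_i}=\int uv\,\mathrm d_i$. The mass matrix is $\mathbf M_{\mathcal V_i}=\bigl[(\psi_i^k,\psi_i^\ell)_{\mathcal V_i}\bigr]_{k,\ell=1,\dots,d_i}\in\mathbb R^{d_i\times d_i}$, and $\mathbf L_{\mathcal V_i}\in\mathbb R^{d_i\times d_i}$ is a factor with $\mathbf M_{\mathcal V_i}=\mathbf L_{\mathcal V_i}\mathbf L_{\mathcal V_i}^{\mathsf T}$ (invertible, since $\mathbf M_{\mathcal V_i}$ is). The formal column vector of basis functions is $\Psi_i=[\psi_i^1,\dots,\psi_i^{d_i}]^{\mathsf T}$. Product space. For subspaces $\mathcal U_i\subset\mathcal V_i$, $\mathcal U_1\cdot\mathcal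 U_2\dotsm\mathcal U_N$ denotes the space of functions of $N$ variables spanned by all products $u_1u_2\dotsm u_N$, $u_i\in\mathcal U_i$ (the $i$-th factor depending on the $i$-th variable). $\mathcal V=\mathcal V_1\cdot\mathcal V_2\dotsm\mathcal V_N$ is equipped with the inner product $(y,z)_{\mathcal V}=\int\!\int\dotsm\int yz\,\mathrm d_1\,\mathrm d_2\dotsm\mathrm d_N$ and induced norm $\|\cdot\|_{\mathcal V}$. Each $x\in\mathcal V$ is written $x=\sum_{k_1=1}^{d_1}\dotsm\sum_{k_N=1}^{d_N}\mathbf x^{k_1k_2\dotsm k_N}\psi_1^{k_1}\psi_2^{k_2}\dotsm\psi_N^{k_N}$ with coefficient tensor $\mathbf X=[\mathbf x^{k_1k_2\dotsm k_N}]$; equivalently $x=\operatorname{vec}(\mathbf X)^{\mathsf T}[\Psi_N\otimes\dotsm\otimes\Psi_1]$. Conventions. $\otimes$ is the Kronecker product; $\operatorname{vec}$ stacks the tensor entries into a column with the first index running fastest, then the second, etc. For any $N$-dimensional tensor, the mode-1 matricization $(\cdot)^{(1)}$ is the matrix whose rows are indexed by the first tensor index and whose columns are indexed by the remaining indices, the second index running fastest, then the third, etc. The factor $\mathbf L_{\mathcal V_{i-1}}\otimes\dotsm\otimes\mathbf L_{\mathcal V_1}$ is void for $i=1$ and $\mathbf L_{\mathcal V_N}\otimes\dotsm\otimes\mathbf L_{\mathcal V_{i+1}}$ is void for $i=N$ (an empty product is the scalar $1$). ''The $\hat d_i$ leading left singular vectors'' of a matrix are the first $\hat d_i$ columns of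 the orthogonal factor $U$ in a (full) singular value decomposition $U\Sigma W^{\mathsf T}$ with singular values in decreasing order. Cyclic permutation. The operator $\Pi$ maps a tensor of size $n_1\times n_2\times\dots\times n_N$ (for any sizes $n_j$) to a tensor of size $n_2\times\dots\times n_N\times n_1$ by $(\Pi\mathbf X)^{k_2\dotsm k_N k_1}=\mathbf x^{k_1k_2\dotsm k_N}$; $\Pi^{i-1}$ is its $(i-1)$-fold application, so $\Pi^{i-1}\mathbf X$ has size $d_i\times\dots\times d_N\times d_1\times\dots\times d_{i-1}$. *)

(* Defs.v *)
From HB Require Import structures.
From mathcomp Require Import all_boot all_order all_algebra.
From mathcomp Require Import mxtens.
From mathcomp Require Import all_classical all_reals all_analysis.

Set Implicit Arguments.
Unset Strict Implicit.
Unset Printing Implicit Defensive.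
Import Order.TTheory GRing.Theory Num.Theory.
Local Open Scope classical_set_scope.
Local Open Scope ring_scope.

Definition fspan (R : realType) (S : Type) (A : set (S -> R)) : set (S -> R) :=
  [set f | exists (m : nat) (c : 'I_m -> R) (g : 'I_m -> S -> R),
     (forall l, A (g l)) /\ f = (fun s => \sum_(l < m) c l * g l s)].

Definition lin_indep (R : realType) (S : Type) (m : nat) (g : 'I_m -> S -> R) :=
  forall c : 'I_m -> R,
    (forall s, \sum_(l < m) c l * g l s = 0) -> forall l, c l = 0.

Definition is_subspace_of_dim (R : realType) (S : Type) (W : set (S -> R))
    (m : nat) :=
  exists b : 'I_m -> S -> R, lin_indep b /\ W = fspan (range b).

Definition L2_inner (R : realType) (disp : measure_display)
    (T : measurableType disp) (mu : {measure set T -> \bar R})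
    (u v : T -> R) : R :=
  Rintegral mu setT (fun t => u t * v t).

(* Linear independence is required modulo null functions: the span is a Hilbert
   space for [L2_inner], so only the zero combination may vanish a.e.  Hence
   distinct elements of the span are distinct in L2, and the span can be handled
   as a space of genuine functions. *)
Definition L2_basis (R : realType) (disp : measure_display)
    (T : measurableType disp) (mu : {measure set T -> \bar R})
    (m : nat) (psi : 'I_m -> T -> R) :=
  (forall k, psi k \in Lfun mu 2%:E) /\
  (forall c : 'I_m -> R,
     {ae mu, forall t, \sum_(k < m) c k * psi k t = 0} -> forall k, c k = 0).

Definition mass_matrix (R : realType) (disp : measure_display)
    (T : measurableType disp) (mu : {measure set T -> \bar R})
    (m : nat) (psi : 'I_m -> T -> R) : 'M[R]_m :=
  \matrix_(k, l) L2_inner mu (psi k) (psi l).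

(* The span of all products of elements of the U j, the j-th factor depending
   on the j-th variable only. *)
Definition prodspace (R : realType) (I : finType) (T : I -> Type)
    (U : forall j, set (T j -> R)) : set ((forall j, T j) -> R) :=
  fspan [set f | exists u : forall j, T j -> R,
           (forall j, U j (u j)) /\ f = (fun t => \prod_j u j (t j))].

Section IteratedIntegral.
Variables (R : realType) (N : nat) (disp : 'I_N -> measure_display).
Variables (T : forall j, measurableType (disp j)).
Variables (mu : forall j, {measure set (T j) -> \bar R}).
Local Notation point_T := (forall j, T j).

Definition integrate_var (j : 'I_N) (f : point_T -> R) : point_T -> R :=
  fun t => Rintegral (mu j) setT (fun y : T j => f (dfwith t j y)).

(* The variables are integrated in the order 1, ..., N (d_1 innermost); the
   result no longer depends on t, so it is read off at an arbitrary point. *)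
Definition iterated_integral (f : point_T -> R) : R :=
  foldl (fun g j => integrate_var j g) f (enum 'I_N) (fun j => point).

Definition V_inner (y z : point_T -> R) : R :=
  iterated_integral (fun t => y t * z t).

Definition V_norm (y : point_T -> R) : R := Num.sqrt (V_inner y y).

End IteratedIntegral.

Definition is_min (R : realType) (E : set R) (m : R) := E m /\ lbound E m.

(* The number N of modes is written n.+1, so that a first mode exists.  Modes
   are 0-based in the code and 1-based in the comments. *)
Section Tensors.
Variables (R : realType) (n : nat).
Implicit Types (sz : 'I_n.+1 -> nat).

Definition midx sz := {dffun forall j : 'I_n.+1, 'I_(sz j)}.

Definition tensor sz := midx sz -> R.

Definition rot_sz sz : 'I_n.+1 -> nat := fun j => sz (ordS j).

(* Entry j of an index of the rotated tensor is entry j + 1 of the original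
   index; both successor and predecessor are cyclic. *)
Definition unrot_midx sz (k : midx (rot_sz sz)) : midx sz :=
  [ffun j => cast_ord (congr1 sz (ord_predK j)) (k (ord_pred j))].

Definition cyc_perm sz (X : tensor sz) : tensor (rot_sz sz) :=
  fun k => X (unrot_midx k).

Fixpoint cyc_perm_iter (m : nat) sz (X : tensor sz) :
    tensor (iter m rot_sz sz) :=
  match m return tensor (iter m rot_sz sz) with
  | 0 => X
  | m'.+1 => cyc_perm (@cyc_perm_iter m' sz X)
  end.

(* Size and linear index of a list s of modes, the LAST mode of s running
   fastest, as in a Kronecker product taken in the order of s. *)
Fixpoint kdim sz (s : seq 'I_n.+1) : nat :=
  if s is j :: s' then (sz j * kdim sz s')%N else 1%N.

Fixpoint kindex sz (k : midx sz) (s : seq 'I_n.+1) : 'I_(kdim sz s) :=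
  match s return 'I_(kdim sz s) with
  | [::] => ord0
  | j :: s' => mxtens_index (k j, kindex k s')
  end.

Fixpoint kron sz (A : forall j, 'M[R]_(sz j)) (s : seq 'I_n.+1) :
    'M[R]_(kdim sz s) :=
  match s return 'M[R]_(kdim sz s) with
  | [::] => 1%:M
  | j :: s' => A j *t kron A s'
  end.

(* N, N - 1, ..., 2, so that mode 2 runs fastest. *)
Definition tail_modes : seq 'I_n.+1 :=
  rev [seq j : 'I_n.+1 <- enum 'I_n.+1 | (0 < j)%N].

(* Exactly one multi-index contributes to each entry. *)
Definition mode1 sz (X : tensor sz) : 'M[R]_(sz ord0, kdim sz tail_modes) :=
  \matrix_(r, c)
    \sum_(k : midx sz | (k ord0 == r) && (kindex k tail_modes == c)) X k.

(* The order i - 1, ..., 1, N, ..., i + 1; each half is void when i is extreme. *)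
Definition other_modes (i : 'I_n.+1) : seq 'I_n.+1 :=
  rev [seq j : 'I_n.+1 <- enum 'I_n.+1 | (j < i)%N] ++
  rev [seq j : 'I_n.+1 <- enum 'I_n.+1 | (i < j)%N].

Lemma iter_rot_szE sz m j : iter m rot_sz sz j = sz (iter m (@ordS n.+1) j).
Proof.
by elim: m j => [//|m IH] j; rewrite [LHS]/= /rot_sz IH -iterSr.
Qed.

Lemma val_iter_ordS m (j : 'I_n.+1) :
  nat_of_ord (iter m (@ordS n.+1) j) = ((m + j) %% n.+1)%N.
Proof.
elim: m => [|m IH] /=; first by rewrite add0n modn_small.
by rewrite IH -addn1 modnDml addn1 addSn.
Qed.

Lemma iter_ordS0 (i : 'I_n.+1) : iter i (@ordS n.+1) ord0 = i.
Proof. by apply: val_inj; rewrite /= val_iter_ordS addn0 modn_small. Qed.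

Lemma kdimE sz s : kdim sz s = (\prod_(j <- s) sz j)%N.
Proof. by elim: s => [|j s IH] /=; rewrite ?big_nil // big_cons IH. Qed.

Lemma rot_sz_row sz (i : 'I_n.+1) : iter i rot_sz sz ord0 = sz i.
Proof. by rewrite iter_rot_szE iter_ordS0. Qed.

Lemma rot_sz_col sz (i : 'I_n.+1) :
  kdim (iter i rot_sz sz) tail_modes = kdim sz (other_modes i).
Proof.
rewrite !kdimE /tail_modes /other_modes big_cat.
rewrite !big_rev !big_filter !big_enum_cond.
have bij m : bijective (iter m (@ordS n.+1)).
  elim: m => [|m IH]; first by exists id.
  exact: (bij_comp (@ordS_bij _) IH).
under eq_bigr => j _ do rewrite iter_rot_szE.
transitivity (\prod_(j | j != i) sz j)%N.
  rewrite [RHS](reindex _ (onW_bij _ (bij i))) /=; apply: eq_bigl => j.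
  rewrite -{2}[i]iter_ordS0 (inj_eq (bij_inj (bij i))).
  by rewrite -val_eqE lt0n.
rewrite (bigID (fun j : 'I_n.+1 => (j < i)%N)) /=; congr (_ * _)%N;
  apply: eq_bigl => j; rewrite -val_eqE /=; by case: ltngtP.
Qed.

(* The cast only identifies the sizes of the i-fold rotated tensor with the
   original ones; it does not move entries. *)
Definition rotated_mode1 sz (X : tensor sz) (i : 'I_n.+1) :
    'M[R]_(sz i, kdim sz (other_modes i)) :=
  castmx (rot_sz_row sz i, rot_sz_col sz i) (mode1 (@cyc_perm_iter i sz X)).

End Tensors.

Definition expansion (R : realType) (n : nat) (T : 'I_n.+1 -> Type)
    (d : 'I_n.+1 -> nat) (psi : forall j, 'I_(d j) -> T j -> R)
    (X : tensor R d) : (forall j, T j) -> R :=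
  fun t => \sum_(k : midx d) X k * \prod_j psi j (k j) (t j).

Definition is_svd (R : realType) (m p : nat) (A : 'M[R]_(m, p))
    (U : 'M[R]_m) (S : 'M[R]_(m, p)) (W : 'M[R]_p) :=
  [/\ A = U *m S *m W^T,
      U^T *m U = 1%:M /\ W^T *m W = 1%:M,
      is_diag_mx S,
      (forall (k : 'I_m) (l : 'I_p), k = l :> nat -> 0 <= S k l) &
      (forall (k k' : 'I_m) (l l' : 'I_p), k = l :> nat -> k' = l' :> nat ->
         (k <= k')%N -> S k' l' <= S k l)].

(* A singular value decomposition is not unique; V may come from any of them. *)
Definition leading_left_singular (R : realType) (m p r : nat)
    (hr : (r <= m)%N) (A : 'M[R]_(m, p)) (V : 'M[R]_(m, r)) :=
  exists U S W, is_svd A U S W /\ V = colsub (widen_ord hr) U.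

(* Main.v *)
Require Import Defs.
From HB Require Import structures.
From mathcomp Require Import all_boot all_order all_algebra.
From mathcomp Require Import mxtens.
From mathcomp Require Import all_classical all_reals all_analysis.
From mathcomp Require Import ring.

Set Implicit Arguments.
Unset Strict Implicit.
Unset Printing Implicit Defensive.
Import Order.TTheory GRing.Theory Num.Theory.
Local Open Scope classical_set_scope.
Local Open Scope ring_scope.

(** Fix the mode [i].  Unfolding a coefficient tensor along [i] identifies it
    with a matrix [M], rows indexed by mode [i] and columns by all other modes
    ([rotated_mode1], inverse to [fold_tensor]).  Two facts reduce the theorem
    to matrices.

    The first is that [|expansion psi (fold_tensor M)|^2] is the squared
    Frobenius norm of [L_i^T M K], where [K] is the Kronecker product of the
    factors [L_j] of the other modes ([V_inner_frob2]): the iterated integral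
    of a product of basis functions factors into mass matrix entries, and
    [K K^T] is the Kronecker product of the mass matrices.

    The second is that, when the subspace of mode [i] is spanned by the
    combinations of the basis with coefficients in the rows of [C], the
    product space consists of the tensors with unfolding [C^T Y], [Y] arbitrary
    ([prodspace_expansionP]).

    With [A] the matrix of the statement, and since [K] is invertible, the
    errors for the subspace given by [C] are exactly the numbers [|A - B Y|],
    [B = L_i^T C^T].  The minimum of these is attained at the orthogonal
    projection of [A] on the column space of [B] ([is_min_residual]), and its
    square is [|A|^2 - tr (P A A^T)], [P] the orthogonal projector, which has
    trace [r] because [B] has full column rank ([orthoproj_exists]).  For the
    space built from [V], [B] is [V] itself and [P = V V^T].

    So the claim is that [P = V V^T] maximises [tr (P A A^T)] among the
    orthogonal projectors of trace [r], which is the Ky Fan principle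
    ([leading_left_singularP]).  In the basis of left singular vectors the trace
    is a combination of the squared singular values with weights the diagonal
    entries of a projector; these lie in [[0, 1]] and add up to [r], so no
    choice beats putting weight 1 on the [r] largest values
    ([leading_entries_max]). *)

(** * Least squares and orthogonal projectors *)

Definition frob2 (R : pzRingType) (m p : nat) (A : 'M[R]_(m, p)) : R :=
  \tr (A^T *m A).

Lemma frob2E (R : comPzRingType) (m p : nat) (A : 'M[R]_(m, p)) :
  frob2 A = \sum_j \sum_k A k j ^+ 2.
Proof.
rewrite /frob2 /mxtrace; apply: eq_bigr => j _; rewrite mxE.
by apply: eq_bigr => k _; rewrite mxE.
Qed.

Lemma frob2_ge0 (R : realFieldType) (m p : nat) (A : 'M[R]_(m, p)) :
  0 <= frob2 A.
Proof. by rewrite frob2E; do 2!apply: sumr_ge0 => ? _; apply: sqr_ge0. Qed.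

Lemma frob2_eq0 (R : realFieldType) (m p : nat) (A : 'M[R]_(m, p)) :
  frob2 A = 0 -> A = 0.
Proof.
rewrite frob2E => /eqP; rewrite psumr_eq0; last first.
  by move=> j _; apply: sumr_ge0 => k _; apply: sqr_ge0.
move=> /allP h; apply/matrixP => k j; rewrite mxE.
have := h j (mem_index_enum _).
rewrite psumr_eq0 => [/allP/(_ k)|*]; last first.
  exact: sqr_ge0.
by rewrite mem_index_enum sqrf_eq0 => /(_ isT)/eqP.
Qed.

(** A Gram matrix [A A^T] has the same left kernel as [A]: if [u A A^T = 0] then
    [|u A|^2 = tr (u A A^T u^T) = 0]. *)
Lemma mulmx_gram_eq0 (R : realFieldType) (q m p : nat) (u : 'M[R]_(q, m))
    (A : 'M[R]_(m, p)) : u *m (A *m A^T) = 0 -> u *m A = 0.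
Proof.
move=> h; apply: trmx_inj; rewrite trmx0; apply: frob2_eq0.
by rewrite /frob2 trmxK trmx_mul mulmxA -(mulmxA u A A^T) h mul0mx mxtrace0.
Qed.

(** [P] is the orthogonal projector onto the column space of [B]; the last
    clause keeps its range inside that space. *)
Definition orthoproj (R : pzRingType) (m r : nat) (P : 'M[R]_m)
    (B : 'M[R]_(m, r)) :=
  [/\ P^T = P, P *m P = P, P *m B = B & exists C, P = B *m C].

(** The projector is [B (B^T B)^-1 B^T], and its trace is that of
    [(B^T B)^-1 B^T B], the identity of size [r]. *)
Lemma orthoproj_exists (R : realFieldType) (m r : nat) (B : 'M[R]_(m, r)) :
  row_free B^T -> exists P, orthoproj P B /\ \tr P = r%:R.
Proof.
move=> fB; pose G := B^T *m B.
have uG : G \in unitmx.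
  rewrite -row_free_unit -kermx_eq0; apply/eqP/(row_free_inj fB).
  rewrite mul0mx; apply: mulmx_gram_eq0.
  by rewrite trmxK; apply: mulmx_ker.
have sG : (invmx G)^T = invmx G by rewrite trmx_inv trmx_mul trmxK.
exists (B *m invmx G *m B^T); split.
  split.
  - by rewrite !trmx_mul trmxK sG mulmxA.
  - rewrite -!mulmxA; congr (_ *m _); rewrite !mulmxA -(mulmxA _ B^T).
    by rewrite mulVmx // mul1mx.
  - by rewrite -!mulmxA mulVmx // mulmx1.
  - by exists (invmx G *m B^T); rewrite mulmxA.
by rewrite mxtrace_mulC mulmxA mulmxV // mxtrace1.
Qed.

Lemma frob2_orthoD (R : comPzRingType) (m p : nat) (A B : 'M[R]_(m, p)) :
  A^T *m B = 0 -> frob2 (A + B) = frob2 A + frob2 B.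
Proof.
move=> h; rewrite /frob2 [(A + B)^T]raddfD /= mulmxDl !mulmxDr h.
rewrite -[B^T *m A]trmxK trmx_mul trmxK h trmx0.
by rewrite addr0 add0r mxtraceD.
Qed.

Lemma frob2_projE (R : comPzRingType) (m p : nat) (P : 'M[R]_m)
    (A : 'M[R]_(m, p)) : P^T = P -> P *m P = P ->
  frob2 (P *m A) = \tr (P *m (A *m A^T)).
Proof.
move=> sP iP; rewrite /frob2 trmx_mul sP [in LHS]mulmxA -(mulmxA _ P P) iP.
by rewrite -mulmxA mxtrace_mulC mulmxA.
Qed.

(** [A - P A] is orthogonal to every matrix of the form [P Z], and both [P A]
    and [B Y] have that form. *)
Lemma frob2_pythagoras (R : comPzRingType) (m p r : nat) (P : 'M[R]_m)
    (B : 'M[R]_(m, r)) (A : 'M[R]_(m, p)) (Y : 'M[R]_(r, p)) :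
  orthoproj P B ->
  frob2 (A - B *m Y) = frob2 A - \tr (P *m (A *m A^T)) +
                       frob2 (P *m A - B *m Y).
Proof.
case=> sP iP PB _.
have o Z : (A - P *m A)^T *m (P *m Z) = 0.
  rewrite [(A - _)^T]raddfB /= mulmxBl trmx_mul sP -!mulmxA.
  by rewrite (mulmxA P P Z) iP subrr.
rewrite -(frob2_projE A sP iP).
have -> : frob2 A = frob2 (A - P *m A) + frob2 (P *m A).
  by rewrite -frob2_orthoD // subrK.
rewrite addrK -frob2_orthoD.
  by rewrite addrA subrK.
by rewrite -PB -mulmxA -mulmxBr o.
Qed.

(** * The Ky Fan principle for leading singular vectors *)

(** Subtracting a threshold [t] with [D k <= t] for [k >= r] and [D k >= t] for
    [k < r] does not change the difference of the two sides, as both families of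
    weights have sum [r]; after this each term has the right sign. *)
Lemma leading_entries_max (R : realFieldType) (m r : nat) (p D : 'I_m -> R) :
  (r <= m)%N -> (forall k, 0 <= p k <= 1) -> \sum_k p k = r%:R ->
  (forall k l : 'I_m, (k <= l)%N -> D l <= D k) ->
  \sum_k p k * D k <= \sum_(k < m | (k < r)%N) D k.
Proof.
move=> rm p01 sp Dmon.
have [r0|r0] := posnP r.
  rewrite big1 ?r0 ?big1 // => k _.
  move/eqP: sp; rewrite r0 psumr_eq0; last by move=> l _; case/andP: (p01 l).
  by move=> /allP/(_ k (mem_index_enum _))/eqP->; rewrite mul0r.
have r1m : (r.-1 < m)%N by rewrite prednK.
(* The threshold is the last of the [r] leading values. *)
pose t := D (Ordinal r1m).
have cr : \sum_(k < m) ((k < r)%N)%:R = r%:R :> R.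
  under eq_bigr => k _ do rewrite mulrb.
  by rewrite -big_mkcond -(big_ord_widen m (fun=> 1)) // sumr_const card_ord.
rewrite (big_mkcond (fun k : 'I_m => (k < r)%N)) -subr_ge0 -sumrB.
have -> : \sum_(k < m) ((if (k < r)%N then D k else 0) - p k * D k) =
   \sum_(k < m) (((k < r)%N)%:R - p k) * (D k - t).
  under [RHS]eq_bigr => k _ do rewrite mulrBr.
  rewrite [RHS]sumrB -mulr_suml [X in _ - X * _]sumrB cr sp subrr mul0r subr0.
  by apply: eq_bigr => k _; case: ifP => _; rewrite mulrBl ?mul1r ?mul0r.
apply: sumr_ge0 => k _; have /andP[pk0 pk1] := p01 k.
case: ltnP => kr /=.
  by rewrite mulr_ge0 // subr_ge0 // Dmon //= -ltnS prednK.
rewrite mulr_le0 // ?sub0r ?oppr_le0 // subr_le0 Dmon //=.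
by rewrite (leq_trans _ kr) ?leq_pred.
Qed.

(** [P k k] is the squared norm of row [k], hence at least [(P k k)^2]. *)
Lemma proj_diag_itv (R : realFieldType) (m : nat) (P : 'M[R]_m) k :
  P^T = P -> P *m P = P -> 0 <= P k k <= 1.
Proof.
move=> sP iP.
have e : P k k = \sum_l P k l ^+ 2.
  rewrite -{1}iP mxE; apply: eq_bigr => l _.
  by rewrite -{2}sP mxE.
have p0 : 0 <= P k k by rewrite e sumr_ge0 // => l _; apply: sqr_ge0.
rewrite p0 /=; case: (ltP 0 (P k k)) => [pp|/le_trans->//].
rewrite -(ler_pM2l pp) mulr1 -expr2 {2}e (bigD1 k) //= lerDl.
by rewrite sumr_ge0 // => l _; apply: sqr_ge0.
Qed.

(** For the diagonal factor of a singular value decomposition, this is the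
    [k]-th squared singular value, extended by 0 when there are more rows than
    columns. *)
Definition row_sqnorm (R : pzRingType) (m p : nat) (S : 'M[R]_(m, p))
    (k : 'I_m) : R :=
  \sum_l S k l ^+ 2.

Lemma diag_mulmx_trmx (R : pzRingType) (m p : nat) (S : 'M[R]_(m, p)) :
  is_diag_mx S -> S *m S^T = diag_mx (\row_k row_sqnorm S k).
Proof.
move=> /is_diag_mxP dS; apply/matrixP => k l; rewrite !mxE /row_sqnorm.
have [<-|kl] := eqVneq k l; last first.
  rewrite mulr0n big1 // => c _; rewrite !mxE.
  have [kc|kc] := eqVneq (k : nat) c.
    by rewrite [S l c]dS ?mulr0 // -kc eq_sym.
  by rewrite dS ?mul0r.
by rewrite mulr1n; apply: eq_bigr => c _; rewrite mxE expr2.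
Qed.

Lemma diag_row_sqnormE (R : pzRingType) (m p : nat) (S : 'M[R]_(m, p))
    (k : 'I_m) :
  is_diag_mx S ->
  (forall l : 'I_p, k = l :> nat -> row_sqnorm S k = S k l ^+ 2) /\
  ((p <= k)%N -> row_sqnorm S k = 0).
Proof.
move=> /is_diag_mxP dS; split.
  move=> l kl; rewrite /row_sqnorm (bigD1 l) //= big1 ?addr0 // => c cl.
  by rewrite dS ?expr0n // kl eq_sym.
move=> pk; rewrite /row_sqnorm big1 // => c _; rewrite dS ?expr0n //.
by rewrite neq_ltn (leq_trans (ltn_ord c) pk) orbT.
Qed.

Lemma row_sqnorm_nonincreasing (R : realFieldType) (m p : nat)
    (S : 'M[R]_(m, p)) :
  is_diag_mx S ->
  (forall (k : 'I_m) (l : 'I_p), k = l :> nat -> 0 <= S k l) ->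
  (forall (k k' : 'I_m) (l l' : 'I_p), k = l :> nat -> k' = l' :> nat ->
         (k <= k')%N -> S k' l' <= S k l) ->
  forall k l : 'I_m, (k <= l)%N -> row_sqnorm S l <= row_sqnorm S k.
Proof.
move=> dS S0 Smon k l kl.
have D0 : 0 <= row_sqnorm S k by apply: sumr_ge0 => c _; apply: sqr_ge0.
have [pl|lp] := leqP p l; first by rewrite (diag_row_sqnormE l dS).2.
rewrite ((diag_row_sqnormE l dS).1 (Ordinal lp)) //.
rewrite ((diag_row_sqnormE k dS).1 (Ordinal (leq_ltn_trans kl lp))) //.
by rewrite lerXn2r ?nnegrE ?S0 ?Smon.
Qed.

Lemma trace_proj_diag (R : comPzRingType) (m : nat) (U P : 'M[R]_m)
    (D : 'rV[R]_m) :
  \tr (P *m (U *m diag_mx D *m U^T)) = \sum_k (U^T *m P *m U) k k * D 0 k.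
Proof.
rewrite !mulmxA mxtrace_mulC !mulmxA /mxtrace.
by apply: eq_bigr => k _; rewrite mul_mx_diag mxE.
Qed.

(** The Ky Fan maximum principle for [A A^T = U D U^T]: conjugation by [U] turns
    [P] into a projector [Q] with the same trace and [tr (P A A^T)] into
    [sum_k Q k k * D k], while [V V^T] becomes the projector onto the first [r]
    coordinates. *)
Lemma leading_left_singularP (R : realType) (m p r : nat) (hr : (r <= m)%N)
    (A : 'M[R]_(m, p)) (V : 'M[R]_(m, r)) :
  leading_left_singular hr A V ->
  V^T *m V = 1%:M /\
  forall P : 'M[R]_m, P^T = P -> P *m P = P -> \tr P = r%:R ->
    \tr (P *m (A *m A^T)) <= \tr (V *m V^T *m (A *m A^T)).
Proof.
move=> [U [S [W [[eA [UU WW] dS S0 Smon] eV]]]].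
have UU' := mulmx1C UU.
have VTV : V^T *m V = 1%:M.
  apply/matrixP => a b; rewrite eV !mxE.
  transitivity ((U^T *m U) (widen_ord hr a) (widen_ord hr b)).
    by rewrite mxE; apply: eq_bigr => k _; rewrite !mxE.
  by rewrite UU mxE.
have AA : A *m A^T = U *m diag_mx (\row_k row_sqnorm S k) *m U^T.
  rewrite -diag_mulmx_trmx // eA !trmx_mul trmxK !mulmxA.
  by rewrite -(mulmxA _ W^T W) WW mulmx1.
split=> // P sP iP tP; rewrite AA !trace_proj_diag.
have eUV k : (U^T *m (V *m V^T) *m U) k k = ((k < r)%N)%:R.
  have UV l : (U^T *m V) k l = (k == widen_ord hr l)%:R.
    transitivity ((U^T *m U) k (widen_ord hr l)).
      by rewrite eV !mxE; apply: eq_bigr => c _; rewrite !mxE.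
    by rewrite UU mxE.
  transitivity ((U^T *m V *m (U^T *m V)^T) k k).
    by rewrite trmx_mul trmxK !mulmxA.
  rewrite mxE; case: ltnP => kr.
    rewrite (bigD1 (Ordinal kr)) //= big1 ?addr0.
      rewrite [(_^T) _ _]mxE UV; case: eqP => [_|[]]; last exact: val_inj.
      by rewrite mulr1.
    move=> l lk; rewrite UV; case: eqP => [kl|]; last by rewrite mul0r.
    by case/eqP: lk; apply: val_inj; apply: esym; exact: (congr1 val kl).
  rewrite big1 // => l _; rewrite UV; case: eqP => [kl|]; last by rewrite mul0r.
  by move: kr; rewrite kl /= leqNgt ltn_ord.
have sQ : (U^T *m P *m U)^T = U^T *m P *m U.
  by rewrite !trmx_mul trmxK sP mulmxA.
have iQ : (U^T *m P *m U) *m (U^T *m P *m U) = U^T *m P *m U.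
  rewrite -!mulmxA (mulmxA U) UU' mul1mx (mulmxA P P) iP //.
under [leRHS]eq_bigr => k _ do rewrite eUV mxE.
under [leLHS]eq_bigr => k _ do rewrite [(\row__ _) _ _]mxE.
under [leRHS]eq_bigr => k _ do rewrite mulr_natl mulrb.
rewrite -big_mkcond /=.
apply: leading_entries_max => //.
- by move=> k; apply: proj_diag_itv.
- change (\tr (U^T *m P *m U) = r%:R).
  by rewrite mxtrace_mulC mulmxA UU' mul1mx.
- exact: row_sqnorm_nonincreasing.
Qed.

(** * Kronecker products and linear indices *)

Lemma kronM (R : realType) (n : nat) (d : 'I_n.+1 -> nat)
    (A B : forall j, 'M[R]_(d j)) s :
  kron (fun j => A j *m B j) s = kron A s *m kron B s.
Proof. by elim: s => [|j s IH] /=; rewrite ?mulmx1 // tensmx_mul IH. Qed.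

Lemma kron_tr (R : realType) (n : nat) (d : 'I_n.+1 -> nat)
    (A : forall j, 'M[R]_(d j)) s :
  kron (fun j => (A j)^T) s = (kron A s)^T.
Proof. by elim: s => [|j s IH] /=; rewrite ?trmx1 // trmx_tens IH. Qed.

Lemma kron1 (R : realType) (n : nat) (d : 'I_n.+1 -> nat) s :
  kron (fun j => 1%:M : 'M[R]_(d j)) s = 1%:M.
Proof.
elim: s => //= j s ->; apply/matrixP => a b.
case: (mxtens_indexP a) => a1 a2; case: (mxtens_indexP b) => b1 b2.
rewrite tensmxE !mxE -natrM mulnb (can_eq (@mxtens_indexK _ _)).
by rewrite -xpair_eqE.
Qed.

Lemma kron_unit (R : realType) (n : nat) (d : 'I_n.+1 -> nat)
    (A : forall j, 'M[R]_(d j)) s :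
  (forall j, A j \in unitmx) -> kron A s \in unitmx.
Proof.
move=> uA; suff /mulmx1_unit[] :
  kron A s *m kron (fun j => invmx (A j)) s = 1%:M.
  by [].
rewrite -kronM -[RHS](kron1 R d s); congr (kron _ s).
by apply/functional_extensionality_dep => j; rewrite mulmxV.
Qed.

Lemma kron_kindex (R : realType) (n : nat) (d : 'I_n.+1 -> nat)
    (A : forall j, 'M[R]_(d j)) (k l : midx d) s :
  kron A s (kindex k s) (kindex l s) = \prod_(j <- s) A j (k j) (l j).
Proof.
elim: s => [|j s IH] /=; first by rewrite big_nil mxE.
by rewrite tensmxE big_cons IH.
Qed.

(** The Kronecker product of the vectors [a j], as a function of the linear index
    of [kindex]. *)
Fixpoint kvec (R : pzRingType) (n : nat) (d : 'I_n.+1 -> nat)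
    (a : forall j, 'I_(d j) -> R) (s : seq 'I_n.+1) : 'I_(kdim d s) -> R :=
  match s return 'I_(kdim d s) -> R with
  | [::] => fun=> 1
  | j :: s' => fun c => a j (mxtens_unindex c).1 * kvec a (mxtens_unindex c).2
  end.

Lemma kvec_kindex (R : pzRingType) (n : nat) (d : 'I_n.+1 -> nat)
    (a : forall j, 'I_(d j) -> R) (k : midx d) s :
  kvec a (kindex k s) = \prod_(j <- s) a j (k j).
Proof.
elim: s => [|j s IH]; first by rewrite big_nil.
rewrite big_cons -IH.
pose F p := a j p.1 * kvec a (s := s) p.2.
exact: (congr1 F (mxtens_indexK (k j, kindex k s))).
Qed.

Lemma kindex_inj (n : nat) (d : 'I_n.+1 -> nat) (k l : midx d) s :
  kindex k s = kindex l s -> {in s, forall j, k j = l j}.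
Proof.
elim: s => [//|j s IH] /= /(can_inj (@mxtens_indexK _ _)) [kj ks] j'.
by rewrite inE => /predU1P[->//|/(IH ks)].
Qed.

(** * Unfolding a tensor along a mode *)

Lemma mem_other_modes (n : nat) (i j : 'I_n.+1) :
  (j \in other_modes i) = (j != i).
Proof.
rewrite mem_cat !mem_rev mem_filter mem_enum mem_filter mem_enum !andbT.
by rewrite -neq_ltn.
Qed.

Lemma other_modes_uniq (n : nat) (i : 'I_n.+1) : uniq (other_modes i).
Proof.
rewrite cat_uniq !rev_uniq; apply/and3P; split; try exact/filter_uniq/enum_uniq.
apply/hasPn => j.
rewrite !mem_rev mem_filter mem_enum mem_filter mem_enum !andbT.
by rewrite -leqNgt => /ltnW.
Qed.

Lemma big_other_modes (I : Type) (idx : I) (op : Monoid.com_law idx) (n : nat)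
    (i : 'I_n.+1) (F : 'I_n.+1 -> I) :
  \big[op/idx]_j F j = op (F i) (\big[op/idx]_(j <- other_modes i) F j).
Proof.
rewrite (bigD1 i) //=; congr (op _ _); rewrite -[LHS]big_filter.
apply: perm_big; apply: uniq_perm.
- exact/filter_uniq/index_enum_uniq.
- exact: other_modes_uniq.
- by move=> j; rewrite mem_filter mem_index_enum andbT mem_other_modes.
Qed.

(** The position, in the unfolding along mode [i], of the entry of multi-index
    [k]. *)
Definition mode_index (n : nat) (d : 'I_n.+1 -> nat) (i : 'I_n.+1)
    (k : midx d) : 'I_(d i) * 'I_(kdim d (other_modes i)) :=
  (k i, kindex k (other_modes i)).

Lemma card_midx (n : nat) (d : 'I_n.+1 -> nat) : #|midx d| = (\prod_j d j)%N.
Proof.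

rewrite card_dep_ffun foldrE big_map big_enum /=.
by apply: eq_bigr => j _; rewrite card_ord.
Qed.

(** Injectivity holds as the list of other modes misses only [i]; the two sides
    have the same cardinality. *)
Lemma mode_index_bij (n : nat) (d : 'I_n.+1 -> nat) (i : 'I_n.+1) :
  bijective (@mode_index n d i).
Proof.
apply: inj_card_bij.
  move=> k l [ki /kindex_inj ks]; apply/ffunP => j.
  by have [->|ji] := eqVneq j i; [exact: ki|apply: ks; rewrite mem_other_modes].
by rewrite card_prod !card_ord card_midx kdimE (big_other_modes _ i).
Qed.

Lemma iter_ordS_bij (n m : nat) : bijective (iter m (@ordS n.+1)).
Proof.
elim: m => [|m IH]; first by exists id.
exact: (bij_comp (@ordS_bij _) IH).
Qed.

(** Rotating the modes [n, ..., 1] by [i] gives [i - 1, ..., 0, n, ..., i + 1]: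
    this is what makes the column order of the rotated unfolding agree with the
    order of the Kronecker factors. *)
Lemma map_iter_ordS_tail_modes (n : nat) (i : 'I_n.+1) :
  [seq iter i (@ordS n.+1) j | j <- tail_modes n] = other_modes i.
Proof.
have vfilter (p : pred nat) :
    [seq val j | j <- [seq j <- enum 'I_n.+1 | p (val j)]] =
    [seq k <- iota 0 n.+1 | p k].
  by rewrite -filter_map val_enum_ord.
have lei : (i <= n)%N by rewrite -ltnS.
have eio : iota 0 n.+1 = iota 0 i ++ iota i (n.+1 - i).
  by rewrite -{1}(subnKC (ltnW (ltn_ord i))) iotaD.
have tl : [seq k <- iota 0 n.+1 | (0 < k)%N] = iota 1 n.
  by rewrite /=; apply/all_filterP/allP => k; rewrite mem_iota => /andP[].
have lo : [seq k <- iota 0 n.+1 | (k < i)%N] = iota 0 i.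
  rewrite eio filter_cat (all_filterP _).
    rewrite (eq_in_filter (a2 := pred0)) ?filter_pred0 ?cats0 // => k.
    by rewrite mem_iota => /andP[ik _]; rewrite ltnNge ik.
  by apply/allP => k; rewrite mem_iota.
have hi : [seq k <- iota 0 n.+1 | (i < k)%N] = iota i.+1 (n - i).
  rewrite eio filter_cat subSn //= ltnn.
  rewrite (eq_in_filter (a2 := pred0)) ?filter_pred0 => [|k]; last first.
    by rewrite mem_iota add0n => /andP[_ ki]; rewrite ltnNge ltnW.
  by apply/all_filterP/allP => k; rewrite mem_iota => /andP[].
apply: (inj_map val_inj); rewrite /other_modes /tail_modes -rev_cat.
rewrite !map_rev map_cat.
rewrite (vfilter (fun k => (k < i)%N)) (vfilter (fun k => (i < k)%N)) lo hi.
congr rev; rewrite -map_comp.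
rewrite (eq_map (g := (fun k => (i + k) %% n.+1)%N \o val)); last first.
  by move=> j /=; rewrite val_iter_ordS.
rewrite map_comp (vfilter (fun k => (0 < k)%N)) tl.
have -> : iota 1 n = iota 1 (n - i) ++ iota (n - i).+1 i.
  by rewrite -(iotaD 1) subnK.
rewrite map_cat; congr (_ ++ _).
  rewrite -[i.+1]addn1 iotaDl; apply/eq_in_map => k.
  rewrite mem_iota => /andP[_ kn]; rewrite modn_small //.
  by move: kn; rewrite add1n !ltnS leq_subRL.
rewrite -{1}[(n - i).+1]addn0 iotaDl -map_comp -[RHS]map_id.
apply/eq_in_map => k; rewrite mem_iota add0n /= => ki.
rewrite addnA addnS subnKC // modnDl modn_small //.
by rewrite (ltn_trans ki).
Qed.

(** The sizes on the two sides are only propositionally equal, so the indices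
    are compared as natural numbers. *)
Lemma kindex_val_eq (n : nat) (d e : 'I_n.+1 -> nat) (f : 'I_n.+1 -> 'I_n.+1)
    (k : midx d) (l : midx e) (s : seq 'I_n.+1) :
  (forall j, e j = d (f j)) -> (forall j, l j = k (f j) :> nat) ->
  kindex l s = kindex k [seq f j | j <- s] :> nat.
Proof.
move=> ed lk; elim: s => [//|j s IH] /=; rewrite lk IH; congr (_ * _ + _)%N.
by rewrite !kdimE big_map; apply: eq_bigr => j' _.
Qed.

(** The map [u] undoes the rotation of multi-indices.  It is left abstract: its
    values on the rotated modes determine it, and they avoid all casts. *)
Lemma cyc_perm_iterE (R : realType) (n m : nat) (d : 'I_n.+1 -> nat)
    (X : tensor R d) :
  exists u : midx (iter m (@rot_sz n) d) -> midx d,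
    (forall k, @cyc_perm_iter _ _ m _ X k = X (u k)) /\
    (forall (k : midx (iter m (@rot_sz n) d)) j,
       k j = u k (iter m (@ordS n.+1) j) :> nat).
Proof.
elim: m => [|m [u [Xu uk]]]; first by exists id.
exists (fun k => u (unrot_midx k)); split=> [k|k j] /=.
  by rewrite /cyc_perm Xu.
rewrite -[in RHS]iterS iterSr -uk /unrot_midx ffunE /=.
by congr (nat_of_ord (k _)); rewrite ordSK.
Qed.

(** The sum that defines the entry reduces to one term because [mode_index] is
    injective. *)
Lemma rotated_mode1E (R : realType) (n : nat) (d : 'I_n.+1 -> nat)
    (X : tensor R d) (i : 'I_n.+1) (k : midx d) :
  rotated_mode1 X i (k i) (kindex k (other_modes i)) = X k.
Proof.
have [u [Xu uk]] := cyc_perm_iterE i X.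
have u_bij : bijective u.
  apply: inj_card_bij => [k1 k2 e|].
    by apply/ffunP => j; apply: val_inj; rewrite /= !uk e.
  rewrite !card_midx (reindex _ (onW_bij _ (iter_ordS_bij n i))) /=.
  by under [leqRHS]eq_bigr => j _ do rewrite iter_rot_szE.
have [v uv vu] := u_bij.
rewrite castmxE mxE (big_pred1 (v k)) ?Xu ?vu // => l /=.
rewrite -(can_eq uv) vu -(inj_eq (bij_inj (mode_index_bij d i))) xpair_eqE.
rewrite -!val_eqE /= (uk l ord0) iter_ordS0; congr (_ && (_ == _)).
rewrite (kindex_val_eq (f := iter i (@ordS n.+1)) (k := u l)) //.
  by rewrite map_iter_ordS_tail_modes.
by move=> j; rewrite iter_rot_szE.
Qed.

(** * Integrals of sums of products *)

Lemma Lfun_lincomb (R : realType) (disp : measure_display)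
    (T : measurableType disp) (mu : {measure set T -> \bar R}) (p : \bar R)
    (E : Type) (s : seq E) (w : E -> R) (f : E -> T -> R) :
  (1 <= p)%E -> (forall e, f e \in Lfun mu p) ->
  (fun t => \sum_(e <- s) w e * f e t) \in Lfun mu p.
Proof.
move=> p1 fL; have [L0 LD] := Lfun_submod_closed mu p1.
elim: s => [|e s IH].
  by under eq_fun do rewrite big_nil; exact: L0.
by under eq_fun do rewrite big_cons; exact: (LD (w e) (f e) _ (fL e) IH).
Qed.

Lemma Rintegral_lincomb (R : realType) (disp : measure_display)
    (T : measurableType disp) (mu : {measure set T -> \bar R}) (E : Type)
    (s : seq E) (w : E -> R) (f : E -> T -> R) :
  (forall e, f e \in Lfun mu 1) ->
  Rintegral mu setT (fun t => \sum_(e <- s) w e * f e t) =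
  \sum_(e <- s) w e * Rintegral mu setT (f e).
Proof.
move=> fL; have If g := (Lfun1_integrable mu g).1.
elim: s => [|e s IH].
  under eq_Rintegral do rewrite big_nil.
  by rewrite big_nil /Rintegral integral0.
under eq_Rintegral do rewrite big_cons.
rewrite RintegralD //=.
- by rewrite IH big_cons RintegralZl //; apply: If.
- exact: (integrableZl measurableT (w e) (If _ (fL e))).
- exact/If/Lfun_lincomb.
Qed.

(** By linearity alone, integrating one variable of a sum of products of
    functions of one variable turns one factor of each product into a constant. *)
Lemma foldl_integrate_var (R : realType) (N : nat)
    (disp : 'I_N -> measure_display) (T : forall j, measurableType (disp j))
    (mu : forall j, {measure set (T j) -> \bar R}) (E : finType) (w : E -> R)
    (f : E -> forall j, T j -> R) (s : seq 'I_N) :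
  uniq s -> (forall e j, f e j \in Lfun (mu j) 1) ->
  foldl (fun g j => integrate_var mu j g)
    (fun t => \sum_e w e * \prod_(j <- s) f e j (t j)) s =
  fun=> \sum_e w e * \prod_(j <- s) Rintegral (mu j) setT (f e j).
Proof.
move=> + fL; elim: s w => [|j s IH] w /=.
  by move=> _; apply/funext => t; apply: eq_bigr => e _; rewrite !big_nil.
move=> /andP[js us].
have -> : integrate_var mu j
    (fun t => \sum_e w e * \prod_(l <- j :: s) f e l (t l)) =
    fun t => \sum_e (w e * Rintegral (mu j) setT (f e j)) *
                    \prod_(l <- s) f e l (t l).
  apply/funext => t; rewrite /integrate_var.
  under eq_Rintegral => y _.
    under eq_bigr => e _.
      rewrite big_cons dfwithin.
      rewrite (eq_big_seq (fun l => f e l (t l))) => [|l ls]; last first.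
        rewrite dfwithout //; apply: contraNneq js => ->; exact: ls.
      rewrite mulrCA mulrC.
    over.
  over.
  rewrite Rintegral_lincomb //.
  by apply: eq_bigr => e _; rewrite mulrAC.
rewrite IH //; apply/funext => _; apply: eq_bigr => e _.
by rewrite big_cons mulrA.
Qed.

Lemma V_inner_expansion (R : realType) (n : nat)
    (disp : 'I_n.+1 -> measure_display) (T : forall j, measurableType (disp j))
    (mu : forall j, {measure set (T j) -> \bar R}) (d : 'I_n.+1 -> nat)
    (psi : forall j, 'I_(d j) -> T j -> R) (X Y : tensor R d) :
  (forall j k, psi j k \in Lfun (mu j) 2%:E) ->
  V_inner mu (expansion psi X) (expansion psi Y) =
  \sum_k \sum_l X k * Y l * \prod_j mass_matrix (mu j) (psi j) (k j) (l j).
Proof.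
move=> psi2; rewrite /V_inner /iterated_integral.
pose f (kl : midx d * midx d) (j : 'I_n.+1) (t : T j) :=
  psi j (kl.1 j) t * psi j (kl.2 j) t.
have -> : (fun t => expansion psi X t * expansion psi Y t) =
    fun t => \sum_kl X kl.1 * Y kl.2 * \prod_(j <- enum 'I_n.+1) f kl j (t j).
  apply/funext => t; rewrite /expansion mulr_suml.
  rewrite (eq_bigr (fun k : midx d => \sum_(l : midx d)
    X k * Y l * \prod_(j <- enum 'I_n.+1) f (k, l) j (t j))); last first.
    move=> k _; rewrite mulr_sumr; apply: eq_bigr => l _.
    by rewrite mulrACA -big_split big_enum.
  by rewrite pair_bigA.
rewrite foldl_integrate_var ?enum_uniq //; last first.
  by move=> kl j; apply: Lfun2_mul_Lfun1.
rewrite pair_bigA; apply: eq_bigr => -[k l] _ /=; congr (_ * _).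
by rewrite big_enum; apply: eq_bigr => j _; rewrite mxE.
Qed.

(** If [v L = 0] then [v M v^T = 0] for the mass matrix [M = L L^T]; this is the
    integral of the square of the combination of [psi] with coefficients [v], so
    that combination vanishes almost everywhere and [v = 0]. *)
Lemma gram_factor_unit (R : realType) (disp : measure_display)
    (T : measurableType disp) (mu : {measure set T -> \bar R})
    (m : nat) (psi : 'I_m -> T -> R) (L : 'M[R]_m) :
  L2_basis mu psi -> mass_matrix mu psi = L *m L^T -> L \in unitmx.
Proof.
move=> [psi2 psi_free] eL; rewrite -row_free_unit -kermx_eq0; apply/eqP.
apply/row_matrixP => a; rewrite row0.
have : row a (kermx L) *m L = 0 by rewrite -row_mul mulmx_ker row0.
move: (row a _) => v vL.
apply/rowP => k; rewrite [RHS]mxE; apply: (psi_free (fun k => v 0 k)).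
pose g t := \sum_k v 0 k * psi k t.
have g2 : g \in Lfun mu 2%:E.
  by apply: Lfun_lincomb => //; rewrite lee_fin ler1n.
have gg1 : g \* g \in Lfun mu 1 by exact: Lfun2_mul_Lfun1.
have Igg : mu.-integrable setT (EFin \o (g \* g)).
  exact/Lfun1_integrable.
have gg0 : Rintegral mu setT (g \* g) = 0.
  pose f (ab : 'I_m * 'I_m) t := psi ab.1 t * psi ab.2 t.
  have -> : g \* g = fun t => \sum_ab v 0 ab.1 * v 0 ab.2 * f ab t.
    apply/funext => t; rewrite /= /g mulr_suml.
    rewrite -(pair_bigA _ (fun b c => v 0 b * v 0 c * f (b, c) t)) /=.
    apply: eq_bigr => b _; rewrite mulr_sumr; apply: eq_bigr => c _.
    by rewrite mulrACA.
  rewrite Rintegral_lincomb => [|ab]; last exact: Lfun2_mul_Lfun1.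
  transitivity ((v *m mass_matrix mu psi *m v^T) 0 0); last first.
    by rewrite eL mulmxA vL !mul0mx mxE.
  rewrite -(pair_bigA _ (fun b c => v 0 b * v 0 c * Rintegral mu setT (f (b, c)))).
  rewrite exchange_big mxE; apply: eq_bigr => c _; rewrite !mxE mulr_suml.
  by apply: eq_bigr => b _; rewrite mxE mulrAC.
have gg0' : (\int[mu]_t `|(g t * g t)%:E| = 0)%E.
  transitivity (\int[mu]_t ((g \* g) t)%:E)%E.
    by apply: eq_integral => t _; rewrite gee0_abs // lee_fin -expr2 sqr_ge0.
  have gg_fin : (\int[mu]_t ((g \* g) t)%:E)%E \is a fin_num.
    exact: (integrable_fin_num measurableT Igg).
  by rewrite -(fineK gg_fin) -[fine _]/(Rintegral mu setT (g \* g)) gg0.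
have := (ae_eq_integral_abs mu measurableT (measurable_int mu Igg)).1 gg0'.
by apply: filterS => t /(_ I) /= [] /eqP; rewrite mulf_eq0 orbb => /eqP.
Qed.

(** * Tensors and their unfoldings *)

Lemma mxtrace_bilinear (R : comPzRingType) (m p : nat) (Z : 'M[R]_(m, p))
    (M : 'M[R]_m) (N : 'M[R]_p) :
  \tr (Z^T *m M *m Z *m N^T) =
  \sum_ac \sum_be Z ac.1 ac.2 * Z be.1 be.2 * (M ac.1 be.1 * N ac.2 be.2).
Proof.
have entryE c : (Z^T *m M *m Z *m N^T) c c =
    \sum_e \sum_b \sum_a Z a c * Z b e * (M a b * N c e).
  rewrite mxE; apply: eq_bigr => e _; rewrite !mxE mulr_suml.
  apply: eq_bigr => b _; rewrite mxE !mulr_suml; apply: eq_bigr => a _.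
  by rewrite mxE; ring.
rewrite /mxtrace (eq_bigr _ (fun c _ => entryE c)) -(pair_bigA _ (fun a c =>
  \sum_be Z a c * Z be.1 be.2 * (M a be.1 * N c be.2))) [RHS]exchange_big /=.
apply: eq_bigr => c _; rewrite exchange_big pair_bigA exchange_big.
by apply: eq_bigr => a _.
Qed.

Definition fold_tensor (R : realType) (n : nat) (d : 'I_n.+1 -> nat)
    (i : 'I_n.+1) (M : 'M[R]_(d i, kdim d (other_modes i))) : tensor R d :=
  fun k => M (k i) (kindex k (other_modes i)).

Lemma rotated_mode1K (R : realType) (n : nat) (d : 'I_n.+1 -> nat)
    (i : 'I_n.+1) (X : tensor R d) : fold_tensor (rotated_mode1 X i) = X.
Proof. by apply/funext => k; rewrite /fold_tensor rotated_mode1E. Qed.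

Lemma fold_tensorK (R : realType) (n : nat) (d : 'I_n.+1 -> nat)
    (i : 'I_n.+1) (M : 'M[R]_(d i, kdim d (other_modes i))) :
  rotated_mode1 (fold_tensor M) i = M.
Proof.
have [g gK mK] := mode_index_bij d i.
apply/matrixP => a c; have [k [<- <-]] : exists k, mode_index i k = (a, c).
  by exists (g (a, c)).
exact: rotated_mode1E.
Qed.

(** The squared norm of a tensor is the quadratic form of the Kronecker product
    of all mass matrices; split off mode [i] and factor both parts. *)
Lemma V_inner_frob2 (R : realType) (n : nat)
    (disp : 'I_n.+1 -> measure_display) (T : forall j, measurableType (disp j))
    (mu : forall j, {measure set (T j) -> \bar R}) (d : 'I_n.+1 -> nat)
    (psi : forall j, 'I_(d j) -> T j -> R) (L : forall j, 'M[R]_(d j))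
    (i : 'I_n.+1) (M : 'M[R]_(d i, kdim d (other_modes i))) :
  (forall j k, psi j k \in Lfun (mu j) 2%:E) ->
  (forall j, mass_matrix (mu j) (psi j) = L j *m (L j)^T) ->
  V_inner mu (expansion psi (fold_tensor M)) (expansion psi (fold_tensor M)) =
  frob2 ((L i)^T *m M *m kron L (other_modes i)).
Proof.
move=> psi2 hL; rewrite V_inner_expansion //.
pose N := kron (fun j => L j *m (L j)^T) (other_modes i).
have NE : kron L (other_modes i) *m (kron L (other_modes i))^T = N^T.
  by rewrite /N kronM kron_tr trmx_mul trmxK.
transitivity (\tr (M^T *m (L i *m (L i)^T) *m M *m N^T)); last first.
  rewrite -NE /frob2 !trmx_mul trmxK [in LHS]mulmxA [LHS]mxtrace_mulC.
  by rewrite !mulmxA.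
rewrite mxtrace_bilinear.
rewrite (reindex _ (onW_bij _ (mode_index_bij d i))); apply: eq_bigr => k _.
rewrite (reindex _ (onW_bij _ (mode_index_bij d i))); apply: eq_bigr => l _.
rewrite /= /N kron_kindex; congr (_ * _).
by rewrite (big_other_modes _ i) /= hL; under eq_bigr do rewrite hL.
Qed.

(** Distributivity over a list of modes.  Indexing the expanded sum by the
    linear index, rather than by multi-indices, makes it match the columns of the
    unfolding. *)
Lemma prod_sum_kvec (R : comPzRingType) (n : nat) (d : 'I_n.+1 -> nat)
    (a : forall j, 'I_(d j) -> R) (s : seq 'I_n.+1) :
  \prod_(j <- s) (\sum_k a j k) = \sum_c kvec a (s := s) c.
Proof.
elim: s => [|j s IH]; first by rewrite big_nil big_ord1.
by rewrite big_cons IH mulr_sum.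
Qed.

Lemma kvecM (R : comPzRingType) (n : nat) (d : 'I_n.+1 -> nat)
    (a b : forall j, 'I_(d j) -> R) (s : seq 'I_n.+1) c :
  kvec (fun j k => a j k * b j k) (s := s) c = kvec a c * kvec b c.
Proof. by elim: s c => [|j s IH] c /=; rewrite ?mulr1 // IH mulrACA. Qed.

Lemma expansion_fold_tensor (R : realType) (n : nat) (T : 'I_n.+1 -> Type)
    (d : 'I_n.+1 -> nat) (psi : forall j, 'I_(d j) -> T j -> R) (i : 'I_n.+1)
    (M : 'M[R]_(d i, kdim d (other_modes i))) (t : forall j, T j) :
  expansion psi (fold_tensor M) t =
  \sum_c \sum_a M a c * psi i a (t i) * kvec (fun j k => psi j k (t j)) c.
Proof.
rewrite exchange_big pair_bigA /=.
rewrite (reindex _ (onW_bij _ (mode_index_bij d i))); apply: eq_bigr => k _.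
by rewrite /= kvec_kindex (big_other_modes _ i) /= mulrA.
Qed.

(** * Spans and coefficient matrices *)

Lemma fspan_sum (R : realType) (S : Type) (A : set (S -> R)) (E : finType)
    (c : E -> R) (g : E -> S -> R) :
  (forall e, A (g e)) -> fspan A (fun s => \sum_e c e * g e s).
Proof.
move=> Ag; exists #|E|, (c \o enum_val), (g \o enum_val); split=> [l|].
  exact: Ag.
by apply/funext => s; rewrite big_enum_val.
Qed.

Definition comb (R : realType) (S : Type) (m r : nat) (g : 'I_m -> S -> R)
    (C : 'M[R]_(r, m)) (l : 'I_r) (s : S) : R := \sum_k C l k * g k s.

Lemma fspan_rangeP (R : realType) (S : Type) (m : nat) (g : 'I_m -> S -> R)
    (f : S -> R) :
  fspan (range g) f <-> exists c : 'rV_m, f = comb g c 0.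
Proof.
split=> [[p [c [h [hg ->]]]]|[c ->]]; last first.
  by apply: fspan_sum => k; exists k.
have /choice[e eg] l : exists k, g k = h l by have [k _ <-] := hg l; exists k.
exists (\row_k \sum_(l < p | e l == k) c l); apply/funext => s.
rewrite /comb (partition_big e predT) //=; apply: eq_bigr => k _.
by rewrite mxE mulr_suml; apply: eq_bigr => l /eqP <-; rewrite eg.
Qed.

Lemma fspan_gen (R : realType) (S : Type) (A : set (S -> R)) (f : S -> R) :
  A f -> fspan A f.
Proof.
move=> Af; exists 1%N, (fun=> 1), (fun=> f); split=> //.
by apply/funext => s; rewrite big_ord1 mul1r.
Qed.

Lemma comb_mul (R : realType) (S : Type) (m p r : nat) (g : 'I_m -> S -> R)
    (C : 'M[R]_(p, m)) (D : 'M[R]_(r, p)) :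
  comb (comb g C) D = comb g (D *m C).
Proof.
apply/funext => l; apply/funext => s; rewrite /comb.
under eq_bigr do rewrite mulr_sumr.
rewrite exchange_big; apply: eq_bigr => k _; rewrite mxE mulr_suml.
by apply: eq_bigr => q _; rewrite mulrA.
Qed.

Lemma comb_lin_indep (R : realType) (S : Type) (m r : nat) (g : 'I_m -> S -> R)
    (C : 'M[R]_(r, m)) : lin_indep g -> lin_indep (comb g C) <-> row_free C.
Proof.
move=> gfree; split=> [Cfree|Cfree c c0 l].
  rewrite -kermx_eq0; apply/eqP/row_matrixP => a; rewrite row0.
  have : row a (kermx C) *m C = 0 by rewrite -row_mul mulmx_ker row0.
  move: (row a _) => v vC; apply/rowP => l; rewrite [RHS]mxE.
  apply: (Cfree (fun l => v 0 l)) => s.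
  rewrite -[LHS]/(comb (comb g C) v 0 s) comb_mul vC /comb big1 // => k _.
  by rewrite mxE mul0r.
pose v : 'rV[R]_r := \row_l c l.
suff v0 : v = 0 by have := congr1 (fun u : 'rV_r => u 0 l) v0; rewrite !mxE.
apply: (row_free_inj Cfree); rewrite mul0mx; apply/rowP => k; rewrite [RHS]mxE.
apply: (gfree (fun k => (v *m C) 0 k)) => s.
rewrite -[LHS]/(comb g (v *m C) 0 s) -comb_mul -[RHS](c0 s) /comb.
by apply: eq_bigr => q _; rewrite mxE.
Qed.

(** A subspace of dimension [r] of a space with a basis is encoded by the
    coefficient matrix of its own basis, which has full row rank. *)
Lemma subspace_comb (R : realType) (S : Type) (m r : nat) (g : 'I_m -> S -> R)
    (W : set (S -> R)) :
  lin_indep g -> W `<=` fspan (range g) -> is_subspace_of_dim W r ->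
  exists C : 'M[R]_(r, m), row_free C /\ W = fspan (range (comb g C)).
Proof.
move=> gfree Wg [b [bfree eW]].
have /choice[c cb] l : exists c : 'rV_m, b l = comb g c 0.
  by apply/fspan_rangeP/Wg; rewrite eW; apply: fspan_gen; exists l.
have bE : b = comb g (\matrix_l c l).
  apply/funext => l; rewrite cb; apply/funext => s.
  by apply: eq_bigr => k _; rewrite mxE.
exists (\matrix_l c l); split; last by rewrite -bE.
by apply/(comb_lin_indep _ gfree); rewrite -bE.
Qed.

(** * Product spaces and best approximation *)

(** With the column [c] fixed, the product of the corresponding basis functions
    of the other modes is one elementary product.  The induction on the list
    of modes avoids having to complete [c] to a multi-index, which is impossible
    if the remaining mode has dimension 0. *)
Lemma kvec_prodspace (R : realType) (n : nat) (T : 'I_n.+1 -> Type)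
    (d : 'I_n.+1 -> nat) (psi : forall j, 'I_(d j) -> T j -> R)
    (s : seq 'I_n.+1) (c : 'I_(kdim d s)) :
  uniq s -> exists u : forall j, T j -> R,
    (forall j, fspan (range (psi j)) (u j)) /\
    (forall t, kvec (fun j k => psi j k (t j)) c = \prod_(j <- s) u j (t j)).
Proof.
elim: s c => [|j s IH] c.
  move=> _; exists (fun j => comb (psi j) (0 : 'rV_(d j)) 0); split=> [j|t].
    by apply/fspan_rangeP; exists 0.
  by rewrite big_nil.
move=> /andP[js /(IH (mxtens_unindex c).2)[u [uV uE]]].
exists (dfwith u j (psi j (mxtens_unindex c).1)); split=> [l|t].
  case: dfwithP => [|l' _]; last exact: uV.
  by apply: fspan_gen; exists (mxtens_unindex c).1.
rewrite big_cons dfwithin /= uE; congr (_ * _).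
apply: eq_big_seq => l ls; rewrite dfwithout //.
by apply: contraNneq js => ->.
Qed.

Lemma expansion_fold_lincomb (R : realType) (n : nat) (T : 'I_n.+1 -> Type)
    (d : 'I_n.+1 -> nat) (psi : forall j, 'I_(d j) -> T j -> R) (i : 'I_n.+1)
    (E : finType) (w : E -> R)
    (M : E -> 'M[R]_(d i, kdim d (other_modes i))) (t : forall j, T j) :
  expansion psi (fold_tensor (\sum_e w e *: M e)) t =
  \sum_e w e * expansion psi (fold_tensor (M e)) t.
Proof.
under [RHS]eq_bigr => e _ do rewrite mulr_sumr.
rewrite exchange_big; apply: eq_bigr => k _.
rewrite /fold_tensor summxE mulr_suml; apply: eq_bigr => e _.
by rewrite mxE mulrA.
Qed.

(** An elementary product, with mode [i] factor of coefficients [e C] and the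
    other factors of coefficients [a j], has as unfolding the rank one matrix
    [C^T e^T (kvec a)].  Conversely, the entry [Y q c] is the coefficient of
    the product of the [q]-th generator in mode [i] with the product of basis
    functions indexed by [c]. *)
Lemma prodspace_expansionP (R : realType) (n : nat) (T : 'I_n.+1 -> Type)
    (d : 'I_n.+1 -> nat) (psi : forall j, 'I_(d j) -> T j -> R) (i : 'I_n.+1)
    (r : nat) (C : 'M[R]_(r, d i)) (z : (forall j, T j) -> R) :
  prodspace (dfwith (fun j => fspan (range (psi j))) i
                    (fspan (range (comb (psi i) C)))) z <->
  exists Y : 'M[R]_(r, kdim d (other_modes i)),
    z = expansion psi (fold_tensor (C^T *m Y)).
Proof.
set U := dfwith _ _ _.
split=> [[p [w [g [gU ->]]]]|[Y ->]].
  have /choice[Y gE] l : exists Y : 'M[R]_(r, kdim d (other_modes i)),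
      g l = expansion psi (fold_tensor (C^T *m Y)).
    have [u [uU ->]] := gU l.
    have [e ue] : exists e : 'rV_r, u i = comb (psi i) (e *m C) 0.
      have := uU i; rewrite /U dfwithin => /fspan_rangeP[e ->].
      by exists e; rewrite comb_mul.
    have aP j : exists a : 'rV_(d j),
        j != i -> u j = comb (psi j) a 0.
      have [->|ji] := eqVneq j i; first by exists 0.
      have := uU j; rewrite /U dfwithout 1?eq_sym // => /fspan_rangeP[a ->].
      by exists a.
    pose a j := sval (cid (aP j)).
    have ua j : j != i -> u j = comb (psi j) (a j) 0 := svalP (cid (aP j)).
    pose b := kvec (fun j k => a j 0 k) (s := other_modes i).
    exists (\matrix_(q, c) (e 0 q * b c)); apply/funext => t.
    rewrite expansion_fold_tensor (big_other_modes _ i) /= ue.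
    rewrite (eq_big_seq (fun j => \sum_k a j 0 k * psi j k (t j))); last first.
      by move=> j; rewrite mem_other_modes => /ua ->.
    rewrite prod_sum_kvec mulr_sumr; apply: eq_bigr => c _.
    rewrite kvecM /comb -/(b c) mulr_suml; apply: eq_bigr => k _.
    rewrite [(C^T *m _) _ _]mxE [(e *m C) _ _]mxE mulrA; congr (_ * _).
    rewrite !mulr_suml; apply: eq_bigr => q _.
    by rewrite !mxE -/(b c); ring.
  exists (\sum_l w l *: Y l); apply/funext => t.
  rewrite mulmx_sumr; under eq_bigr => l _ do rewrite gE.
  rewrite -expansion_fold_lincomb; congr (expansion _ (fold_tensor _) _).
  by apply: eq_bigr => l _; rewrite -scalemxAr.
have /choice[u uE] c := kvec_prodspace psi c (other_modes_uniq i).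
have -> : expansion psi (fold_tensor (C^T *m Y)) =
    fun t => \sum_qc Y qc.1 qc.2 *
      (comb (psi i) C qc.1 (t i) * \prod_(j <- other_modes i) u qc.2 j (t j)).
  apply/funext => t; rewrite expansion_fold_tensor.
  rewrite -(pair_bigA _ (fun q c => Y q c * (comb (psi i) C q (t i) *
     \prod_(j <- other_modes i) u c j (t j)))) exchange_big /=.
  apply: eq_bigr => c _; rewrite -(uE c).2 -mulr_suml.
  under [RHS]eq_bigr do rewrite mulrA.
  rewrite -mulr_suml; congr (_ * _); rewrite /comb.
  under [RHS]eq_bigr do rewrite mulr_sumr.
  rewrite exchange_big; apply: eq_bigr => a _; rewrite mxE mulr_suml.
  by apply: eq_bigr => q _; rewrite mxE; ring.
apply: fspan_sum => -[q c] /=.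
exists (dfwith (u c) i (comb (psi i) C q)); split=> [j|].
  rewrite /U; case: dfwithP => [|j' ij']; last first.
    by rewrite dfwithout //; exact: (uE c).1.
  by rewrite dfwithin; apply: fspan_gen; exists q.
apply/funext => t; rewrite (big_other_modes _ i) /= dfwithin; congr (_ * _).
apply: eq_big_seq => j; rewrite mem_other_modes => ji.
by rewrite dfwithout 1?eq_sym.
Qed.

Lemma is_min_residual (R : realType) (m p r : nat) (A : 'M[R]_(m, p))
    (B : 'M[R]_(m, r)) (P : 'M[R]_m) :
  orthoproj P B ->
  is_min [set Num.sqrt (frob2 (A - B *m Y)) | Y in [set: 'M[R]_(r, p)]]
         (Num.sqrt (frob2 A - \tr (P *m (A *m A^T)))).
Proof.
move=> oP; have [_ _ _ [C eP]] := oP; split=> [|_ [Y _ <-]].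
  exists (C *m A) => //; rewrite (frob2_pythagoras _ _ oP) (mulmxA B) -eP subrr.
  by rewrite /frob2 mulmx0 mxtrace0 addr0.
by rewrite ler_wsqrtr // (frob2_pythagoras _ _ oP) lerDl frob2_ge0.
Qed.

Theorem theorem2p3 (R : realType) (n : nat)
  (disp : 'I_n.+1 -> measure_display)
  (T : forall j : 'I_n.+1, measurableType (disp j))
  (mu : forall j : 'I_n.+1, {measure set (T j) -> \bar R})
  (d : 'I_n.+1 -> nat)
  (psi : forall j : 'I_n.+1, 'I_(d j) -> T j -> R)
  (hpsi : forall j : 'I_n.+1, L2_basis (mu j) (psi j))
  (L : forall j : 'I_n.+1, 'M[R]_(d j))
  (hL : forall j : 'I_n.+1, mass_matrix (mu j) (psi j) = L j *m (L j)^T)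
  (x : (forall j : 'I_n.+1, T j) -> R)
  (X : tensor R d)
  (hx : x = expansion psi X)
  (i : 'I_n.+1) (r : nat) (hr : (r <= d i)%N)
  (V : 'M[R]_(d i, r))
  (hV : leading_left_singular hr
          ((L i)^T *m rotated_mode1 X i *m kron L (other_modes i)) V) :
  let calV := fun j : 'I_n.+1 => fspan (range (psi j)) in
  let hatpsi := fun (l : 'I_r) (t : T i) =>
        \sum_(k < d i) (V^T *m invmx (L i)) l k * psi i k t in
  let hatV := fspan (range hatpsi) in
  let errors := fun W : set (T i -> R) =>
        [set V_norm mu (fun t => x t - z t) | z in prodspace (dfwith calV i W)] in
  [/\ hatV `<=` calV i,
      is_subspace_of_dim hatV r &
      forall W : set (T i -> R),
        W `<=` calV i -> is_subspace_of_dim W r ->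
        exists m m' : R,
          [/\ is_min (errors hatV) m, is_min (errors W) m' & m <= m']].
Proof.
have uL j : L j \in unitmx := gram_factor_unit (hpsi j) (hL j).
have psi2 j k : psi j k \in Lfun (mu j) 2%:E := (hpsi j).1 k.
have psi_free : lin_indep (psi i).
  by move=> c c0; apply: (hpsi i).2; apply: aeW.
set A := (L i)^T *m rotated_mode1 X i *m kron L (other_modes i) in hV.
have [VV kyfan] := leading_left_singularP hV.
move=> calV hatpsi hatV errors.
have hatpsiE : hatpsi = comb (psi i) (V^T *m invmx (L i)) by [].
have hat_free : row_free (V^T *m invmx (L i)).
  by apply/row_freeP; exists (L i *m V); rewrite mulmxA mulmxKV.
(* The invertible Kronecker factor is absorbed into the free matrix [Y]. *)
have errorsE (C : 'M[R]_(r, d i)) :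
    errors (fspan (range (comb (psi i) C))) =
    [set Num.sqrt (frob2 (A - (L i)^T *m C^T *m Y)) | Y in setT].
  have normE (Y : 'M[R]_(r, kdim d (other_modes i))) :
      V_norm mu (fun t => x t - expansion psi (fold_tensor (C^T *m Y)) t) =
      Num.sqrt (frob2 (A - (L i)^T *m C^T *m (Y *m kron L (other_modes i)))).
    rewrite /V_norm.
    have -> : (fun t => x t - expansion psi (fold_tensor (C^T *m Y)) t) =
        expansion psi (fold_tensor (rotated_mode1 X i - C^T *m Y)).
      apply/funext => t; rewrite hx -{1}(rotated_mode1K i X) -sumrB.
      by apply: eq_bigr => k _; rewrite -mulrBl /fold_tensor !mxE.
    rewrite (V_inner_frob2 _ psi2 hL); congr (Num.sqrt (frob2 _)).
    by rewrite mulmxBr mulmxBl !mulmxA.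
  apply/seteqP; split=> [_ [z /prodspace_expansionP[Y ->] <-]|_ [Y _ <-]].
    by exists (Y *m kron L (other_modes i)).
  pose Y' := Y *m invmx (kron L (other_modes i)).
  exists (expansion psi (fold_tensor (C^T *m Y'))).
    by apply/prodspace_expansionP; exists Y'.
  by rewrite normE mulmxKV // kron_unit.
split.
- move=> _ /fspan_rangeP[c ->]; apply/fspan_rangeP.
  by exists (c *m (V^T *m invmx (L i))); rewrite hatpsiE comb_mul.
- by exists hatpsi; split=> //; apply/(comb_lin_indep _ psi_free).
move=> W WV /(subspace_comb psi_free WV)[C [Cfree eW]].
have [P [oP trP]] : exists P, orthoproj P ((L i)^T *m C^T) /\ \tr P = r%:R.
  apply: orthoproj_exists; rewrite trmx_mul !trmxK.
  by rewrite /row_free mxrankMfree // row_free_unit.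
(* In the coordinates given by [L i] the space of the statement is spanned by the
   orthonormal columns of [V]. *)
have oV : orthoproj (V *m V^T) ((L i)^T *m (V^T *m invmx (L i))^T).
  have -> : (L i)^T *m (V^T *m invmx (L i))^T = V.
    by rewrite -trmx_mul mulmxKV // trmxK.
  split; first by rewrite trmx_mul trmxK.
  - by rewrite !mulmxA -(mulmxA V) VV mulmx1.
  - by rewrite -mulmxA VV mulmx1.
  - by exists V^T.
exists (Num.sqrt (frob2 A - \tr (V *m V^T *m (A *m A^T)))).
exists (Num.sqrt (frob2 A - \tr (P *m (A *m A^T)))); split.
- by rewrite /hatV hatpsiE errorsE; apply: is_min_residual.
- by rewrite eW errorsE; apply: is_min_residual.
case: oP => sP iP _ _.
by rewrite ler_wsqrtr // lerD2l lerN2 kyfan.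
Qed.
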